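(* Let $\mathcal{M}=(G,In,Out,L)$ be a linear compartmental model with $|L|=|In\cup Out|$ such that either $G$ is strongly input-output connected and $|Out|=1$, or $G$ is strongly connected and $|In|=1$. Assume that $\mathcal{M}$ has expected dimension, i.e. the image of its coefficient map has dimension $|E|+|In\cup Out|$. Then the model with an additional leak $(G,In,Out,L\cup\{k\})$ also has expected dimension (image of the coefficient map of dimension $|E|+|In\cup Out|$). Thus every model $(G,In,Out,Leak)$ with $L\subseteq Leak\subseteq V$ also has expected dimension.
   Context: A linear compartmental model $(G,In,Out,Leak)$ consists of a finite directed graph $G=(V,E)$ (no self-loops, no repeated edges) and subsets $In,Out,Leak\subseteq V$ (input, output and leak compartments; $In,Out$ nonempty). Each edge $j\to i$ carries an independent parameter $a_{ij}$ and each $i\in Leak$ an independent parameter $a_{0i}$. The compartmental matrix $A$ has $A_{ij}=a_{ij}$ if $j\to i\in E$; $A_{ii}=-a_{0i}-\sum_{k:\,i\to k\in E}a_{ki}$ if $i\in Leak$; $A_{ii}=-\sum_{k:\,i\to k\in E}a_{ki}$ if $i\notin Leak$; all other entries $0$. The model is the system $x'=Ax+u$, $y_i=x_i$ for $i\in Out$, with $u_i\equiv 0$ for $i\notin In$. When every vertex has a directed path to every output (which holds under the hypotheses here), the input-output equation for $j\in Out$ is $\det(\partial I-A)\,y_j=\sum_{i\in In}(-1)^{i+j}\det(\partial I-A)_{ij}\,u_i$, where $\partial=d/dt$ and $(\cdot)_{ij}$ means delete row $i$ and column $j$. The coefficient map $c:\mathbb{R}^{|E|+|Leak|}\to\mathbb{R}^k$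 collects all nonzero, nonmonic coefficients (polynomials in the parameters) of these equations over all $j\in Out$. A cycle is a closed directed path with no repeated vertices. $G$ is strongly input-output connected if it is connected (as an undirected graph) and every edge lies in a cycle or in a directed path from an input vertex to an output vertex. *)

(* Defs.v *)
From HB Require Import structures.
From mathcomp Require Import all_boot all_order all_algebra ring_quotient.
From mathcomp Require Import classical_sets reals.
From mathcomp Require Import mpoly.

Set Implicit Arguments.
Unset Strict Implicit.
Unset Printing Implicit Defensive.

Import GRing.Theory.

Local Open Scope ring_scope.

(* The pair (j, i) stands for the edge j -> i. *)
Record digraph (n : nat) := Digraph {
  edges :> {set 'I_n * 'I_n};
  edges_noloop : forall i, (i, i) \notin edges }.

Section Graphs.
Variables (n : nat) (G : digraph n).

Definition arc : rel 'I_n := fun u v => (u, v) \in edges G.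

Definition connected_graph : Prop :=
  forall u v, connect (fun x y => arc x y || arc y x) u v.

Definition strongly_connected : Prop := forall u v, connect arc u v.

Definition in_cycle (u v : 'I_n) : Prop :=
  exists c : seq 'I_n, [/\ ucycle arc c, u \in c & next c u = v].

Definition in_io_path (In Out : {set 'I_n}) (u v : 'I_n) : Prop :=
  exists (i : 'I_n) (p : seq 'I_n),
    [/\ i \in In, last i p \in Out, path arc i p, uniq (i :: p)
      & infix [:: u; v] (i :: p)].

Definition strongly_io_connected (In Out : {set 'I_n}) : Prop :=
  connected_graph /\
  forall u v, arc u v -> in_cycle u v \/ in_io_path In Out u v.

End Graphs.

Section Model.
Variables (R : realType) (n : nat) (G : digraph n).
Variables (In Out Leak : {set 'I_n}).

(* The polynomial ring has one variable per edge followed by one variable per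
   leak. *)
Definition nparam : nat := (#|edges G| + #|Leak|)%N.

(* [edge_param i j] is a_ij, the parameter of the edge j -> i; it is 0 when
   there is no such edge. *)
Definition edge_param (i j : 'I_n) : {mpoly R[nparam]} :=
  if [pick e : 'I_#|edges G| | enum_val e == (j, i)] is Some e
  then 'X_(lshift #|Leak| e) else 0.

(* [leak_param i] is a_0i; it is 0 when i is not a leak compartment. *)
Definition leak_param (i : 'I_n) : {mpoly R[nparam]} :=
  if [pick l : 'I_#|Leak| | enum_val l == i] is Some l
  then 'X_(rshift #|edges G| l) else 0.

Definition compartmental_matrix : 'M[{mpoly R[nparam]}]_n :=
  \matrix_(i, j)
    if i == j then - leak_param i - \sum_(k | arc G i k) edge_param k i
    else edge_param i j.

(* The differential operator d/dt is the variable 'X of {poly _}, so that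
   [char_poly_mx] is the matrix dI - A and [cofactor _ i j] is (-1)^(i+j) times
   the determinant of dI - A with row i and column j deleted. *)
Definition io_lhs : {poly {mpoly R[nparam]}} := char_poly compartmental_matrix.

Definition io_rhs (i j : 'I_n) : {poly {mpoly R[nparam]}} :=
  cofactor (char_poly_mx compartmental_matrix) i j.

(* The only nonzero constant coefficients of these equations are the leading
   coefficients 1 of [io_lhs] and of [io_rhs j j]: all the others are
   homogeneous of positive degree in the parameters. *)
Definition coefficients : seq {mpoly R[nparam]} :=
  [seq q <- flatten
     [seq polyseq io_lhs ++
        flatten [seq polyseq (io_rhs i j) | i <- enum In] | j <- enum Out]
   | (q != 0) && (q != 1)].

Definition coefficient_map (a : 'I_nparam -> R) :
    'I_(size coefficients) -> R :=
  fun l => (tnth (in_tuple coefficients) l).@[a].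

End Model.

Definition prime_ideal (A : comNzRingType) (P : {pred A}) : Prop :=
  idealr_closed P /\ prime_idealr_closed P.

Definition prime_chain (A : comNzRingType) (I : A -> Prop) (d : nat)
    (P : nat -> {pred A}) : Prop :=
  [/\ forall r, (r <= d)%N -> prime_ideal (P r),
      forall f, I f -> f \in P 0%N
    & forall r, (r < d)%N ->
        {subset P r <= P r.+1} /\ exists2 f, f \in P r.+1 & f \notin P r].

(* The Krull dimension of A / I, in terms of the primes of A containing I. *)
Definition krull_dim (A : comNzRingType) (I : A -> Prop) (d : nat) : Prop :=
  (exists P, prime_chain I d P) /\
  (forall m P, prime_chain I m P -> (m <= d)%N).

Definition vanishing_ideal (R : realType) (k : nat) (S : set ('I_k -> R))
    (p : {mpoly R[k]}) : Prop :=
  forall x, S x -> p.@[x] = 0.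

(* The dimension of a (semialgebraic) subset S of R^k is that of its Zariski
   closure, i.e. the Krull dimension of the ring of polynomial functions
   on S. *)
Definition has_dimension (R : realType) (k : nat) (S : set ('I_k -> R))
    (d : nat) : Prop :=
  krull_dim (vanishing_ideal S) d.

Definition expected_dimension (R : realType) (n : nat) (G : digraph n)
    (In Out Leak : {set 'I_n}) : Prop :=
  has_dimension (range (@coefficient_map R n G In Out Leak))%classic
    (#|edges G| + #|In :|: Out|).

(* Main.v *)
Require Import Defs.
From mathcomp Require Import all_boot all_order all_algebra.
From mathcomp Require Import reals.
From mathcomp Require Import ring_quotient mpoly.

(** Let [B] be the union of [In] and [Out], and [N] the number [#|E| + #|B|]. The
    dimension for the leaks [Leak] lies between the dimension for [L], which is
    [N] by hypothesis, and [N].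

    Lower bound ([prime_chain_remove_leaks]). Setting the parameters of the leaks
    outside [L] to 0 turns the compartmental matrix of the larger model into that
    of the smaller one, hence each coefficient into the corresponding one, which
    may have become 0 or 1 and then is no longer listed. So the image of the
    smaller coefficient map embeds in that of the larger one, by a polynomial map
    that has a polynomial left inverse, and chains of primes are transported
    ([prime_chain_retract]).

    Upper bound ([prime_chain_expected_le]). The coefficients are functions of the
    compartmental matrix [A] that do not change when [A] is conjugated by a
    diagonal matrix whose entries at the vertices of [B] are 1
    ([io_coef_rescale]). As [G] is connected, it contains a forest with
    [n - #|B|] edges which joins every vertex to [B] ([spanning_forest]), and a
    generic [A] is conjugate in this way to a matrix with entries 1 along the
    forest ([forest_normalize]). The remaining [#|E| - (n - #|B|)] entries at edges
    and [n] diagonal entries are [N] parameters, whichever vertices have leaks. A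
    set in the Zariski closure of the image of a polynomial map from [R ^ N] has
    no chain of primes of length [m > N] ([prime_chain_le_nparam]): such a chain
    provides [m] polynomials that are algebraically independent on the set
    ([prime_chain_indep]), whereas more than [N] polynomials in [N] variables are
    dependent ([mpoly_alg_dependent]). *)

Set Implicit Arguments.
Unset Strict Implicit.
Unset Printing Implicit Defensive.

Import Order.TTheory GRing.Theory Num.Theory.

Local Open Scope ring_scope.

(** * Chains of prime ideals *)

Section PrimeIdeal.
Variables (A : comNzRingType) (P : {pred A}) (prP : prime_ideal P).

Lemma prime_ideal1 : 1 \notin P.
Proof. by case: prP => -[]. Qed.

Lemma prime_idealD u v : u \in P -> v \in P -> u + v \in P.
Proof. by case: prP => -[_ _ clP] _ uP vP; rewrite -[u]mul1r clP. Qed.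

Lemma prime_idealMl a u : u \in P -> a * u \in P.
Proof. by case: prP => -[P0 _ clP] _ uP; rewrite -[_ * _]addr0 clP. Qed.

Lemma prime_idealB u v : u \in P -> v \in P -> u - v \in P.
Proof.
by move=> uP vP; rewrite -mulN1r; apply: prime_idealD => //; apply: prime_idealMl.
Qed.

Lemma prime_ideal_cancelX x e y : x \notin P -> x ^+ e * y \in P -> y \in P.
Proof.
move=> xP; elim: e => [|e IHe]; first by rewrite expr0 mul1r.
case: prP => _ prM; rewrite exprS -mulrA => /prM.
by rewrite (negbTE xP).
Qed.

End PrimeIdeal.

Section ChainIndependence.
Variables (K : fieldType) (A : comAlgType K).

(** Along a strict chain of primes, elements [f r] of the successive differences
    are algebraically independent modulo the smallest prime. A relation whose
    monomials agree on the first [r] exponents is divided by the lowest power of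
    [f r] that occurs, and then read modulo the next prime, where only the
    monomials with that lowest exponent survive; in the end a single nonzero
    constant is left. *)
Lemma prime_chain_indep (I : A -> Prop) (d D : nat) (P : nat -> {pred A})
    (f : 'I_d -> A) (c : {ffun 'I_d -> 'I_D} -> K) :
    prime_chain I d P ->
    (forall r : 'I_d, f r \in P r.+1 /\ f r \notin P r) ->
    \sum_mu c mu *: \prod_i f i ^+ mu i \in P 0%N ->
  forall mu, c mu = 0.
Proof.
move=> [prP _ PS] fP sumP mu1; apply: contraTeq sumP => cmu1.
pose S r (s : {set {ffun 'I_d -> 'I_D}}) :=
  \sum_(mu in s) c mu *: \prod_(i < d | (r <= i)%N) f i ^+ mu i.
suff main (k r : nat) (s : {set {ffun 'I_d -> 'I_D}}) :
    (r + k)%N = d -> s != set0 -> {in s, forall mu, c mu != 0} ->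
    (forall mu nu, mu \in s -> nu \in s ->
      forall i : 'I_d, (i < r)%N -> mu i = nu i) ->
    S r s \notin P r.
  have s_n0 : [set mu | c mu != 0] != set0.
    by apply/set0Pn; exists mu1; rewrite inE.
  have c_n0 : {in [set mu | c mu != 0], forall mu, c mu != 0}.
    by move=> mu; rewrite inE.
  apply: contraNN (main d 0%N _ (add0n d) s_n0 c_n0 _) => //.
  rewrite (bigID (fun mu => c mu != 0)) /= [X in _ + X]big1 ?addr0 => [|mu].
    suff -> : S 0%N [set mu | c mu != 0] =
        \sum_(mu | c mu != 0) c mu *: \prod_i f i ^+ mu i by [].
    by apply: eq_bigl => mu; rewrite inE.
  by rewrite negbK => /eqP->; rewrite scale0r.
elim: k => [|k IHk] in r s *.
  rewrite addn0 => -> /set0Pn[mu smu] /(_ _ smu) cmu s_eq.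
  have -> : s = [set mu].
    apply/setP=> nu; rewrite inE; apply/idP/eqP => [snu|->//].
    by apply/ffunP=> i; apply: s_eq.
  rewrite /S big_set1 big_pred0; last by move=> i; rewrite leqNgt ltn_ord.
  have prd := prP d (leqnn d).
  apply: contraNN (prime_ideal1 prd) => /(prime_idealMl prd ((c mu)^-1)%:A).
  by rewrite mulr_algl scalerA mulVf // scale1r.
rewrite addnS => r_k s_n0 c_n0 s_eq.
have r_d : (r < d)%N by rewrite -r_k ltnS leq_addr.
have [mu0 s_mu0] := set0Pn _ s_n0.
pose j := Ordinal r_d.
have [mu smu mu_min] : exists2 mu, mu \in s &
    forall nu, nu \in s -> (mu j <= nu j)%N.
  by have [mu] := @arg_minnP _ mu0 (mem s) (fun mu => mu j : nat) s_mu0; exists mu.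
pose s' := [set nu in s | nu j == mu j].
suff S'P : S r.+1 s' \notin P r.+1.
  have splitj (nu : {ffun 'I_d -> 'I_D}) : \prod_(i < d | (r <= i)%N) f i ^+ nu i =
      f j ^+ nu j * \prod_(i < d | (r < i)%N) f i ^+ nu i.
    rewrite (bigD1 j) //=; congr (_ * _); apply: eq_bigl => i.
    by rewrite ltn_neqAle andbC eq_sym.
  pose T := \sum_(nu in s :\: s')
    c nu *: (f j ^+ (nu j - mu j).-1 * \prod_(i < d | (r < i)%N) f i ^+ nu i).
  have -> : S r s = f j ^+ mu j * (S r.+1 s' + f j * T).
    rewrite mulrDr mulrA -exprSr !mulr_sumr /S.
    rewrite (big_setID s') /= (setIidPr _); last first.
      by apply/subsetP=> nu; rewrite inE => /andP[].
    congr (_ + _); apply: eq_bigr => nu.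
      by rewrite inE => /andP[_ /eqP nuj]; rewrite splitj nuj -scalerAr.
    rewrite !inE => /andP[+ snu]; rewrite snu /= => nuj.
    rewrite splitj -scalerAr mulrA -exprD; congr (_ *: (_ ^+ _ * _)).
    have lt_mu : (mu j < nu j)%N.
      by rewrite ltn_neqAle mu_min // andbT eq_sym; apply: contra nuj => /eqP/val_inj->.
    by rewrite addSn -addnS prednK ?subn_gt0 // subnKC // ltnW.
  have [fjS fj] := fP j.
  (* The factor f j ^+ mu j is not in P r, and f j is 0 modulo P r.+1. *)
  apply: contra S'P => /(prime_ideal_cancelX (prP r (ltnW r_d)) fj) H.
  have [/(_ _ H) H1 _] := PS r r_d.
  have prS := prP r.+1 r_d.
  rewrite -[S r.+1 s'](addrK (f j * T)); apply: prime_idealB => //.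
  by rewrite mulrC; apply: prime_idealMl.
apply: IHk.
- by rewrite addSn.
- by apply/set0Pn; exists mu; rewrite inE smu eqxx.
- by move=> nu; rewrite inE => /andP[/c_n0].
- move=> nu nu'; rewrite !inE => /andP[snu /eqP nuj] /andP[snu' /eqP nu'j] i.
  rewrite ltnS leq_eqVlt => /predU1P[ir|]; last exact: s_eq.
  have -> : i = j by apply: val_inj.
  by rewrite nuj nu'j.
Qed.

End ChainIndependence.

(** * Algebraic dependence by counting monomials *)

Section Counting.
Variables (K : fieldType) (N : nat).

Lemma mpred_sizeM (p q : {mpoly K[N]}) :
  ((msize (p * q)).-1 <= (msize p).-1 + (msize q).-1)%N.
Proof.
have [->|p0] := eqVneq p 0; first by rewrite mul0r msize0.
have [->|q0] := eqVneq q 0; first by rewrite mulr0 msize0.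
rewrite msizeM //; case: (msize p) (msize q) => [|a] [|b] //=.
- by rewrite leq_pred.
- by rewrite addn0 leq_pred.
- by rewrite addnS.
Qed.

Lemma mpred_size_prodX m (Phi : 'I_m -> {mpoly K[N]}) (e : 'I_m -> nat) :
  ((msize (\prod_i Phi i ^+ e i)).-1 <= \sum_i (msize (Phi i)).-1 * e i)%N.
Proof.
elim/big_rec2: _ => [|i b p _ le_pb]; first by rewrite msize1.
apply: leq_trans (mpred_sizeM _ _) (leq_add _ le_pb).
elim: (e i) => [|k IHk]; first by rewrite expr0 msize1.
by rewrite exprS mulnS; apply: leq_trans (mpred_sizeM _ _) (leq_add _ IHk).
Qed.

(** More than [N] polynomials in [N] variables are algebraically dependent: the
    monomials with exponents smaller than [D] in the [m] polynomials are
    [D ^ m] in number, while they lie in a space of dimension [O(D ^ N)]. *)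
Lemma mpoly_alg_dependent m (Phi : 'I_m -> {mpoly K[N]}) : (N < m)%N ->
  exists D, exists c : {ffun 'I_m -> 'I_D} -> K,
    (exists mu, c mu != 0) /\ \sum_mu c mu *: \prod_i Phi i ^+ mu i = 0.
Proof.
move=> ltNm.
pose delta := (\sum_i (msize (Phi i)).-1)%N.
(* D is such that (delta.+1 * D) ^ N < D ^ N.+1. *)
pose D := (delta.+1 ^ N).+1.
pose B := (delta * D).+1.
pose dual (i : 'I_#|{ffun 'I_m -> 'I_D}|) : {mpoly K[N]} :=
  \prod_j Phi j ^+ (enum_val i : {ffun 'I_m -> 'I_D}) j.
pose mon (nu : {ffun 'I_N -> 'I_B}) : 'X_{1..N} := [multinom (nu i : nat) | i < N].
pose M := \matrix_(i < #|{ffun 'I_m -> 'I_D}|, k < #|{ffun 'I_N -> 'I_B}|)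
  (dual i)@_(mon (enum_val k)).
have ltBD : (#|{ffun 'I_N -> 'I_B}| < #|{ffun 'I_m -> 'I_D}|)%N.
  rewrite !card_ffun !card_ord.
  apply: (@leq_trans (D ^ N.+1)); last by rewrite leq_pexp2l.
  apply: (@leq_ltn_trans ((delta.+1 * D) ^ N)).
    have [->|N_gt0] := posnP N; first by rewrite !expn0.
    by rewrite leq_exp2r //  /B mulSn addnC -addn1 leq_add2l.
  by rewrite expnMn expnSr mulnC ltn_pmul2l ?expn_gt0.
have [v /sub_kermxP vM v0] : exists2 v : 'rV_#|{ffun 'I_m -> 'I_D}|,
    (v <= kermx M)%MS & v != 0.
  apply/rowV0Pn; rewrite kermx_eq0 /row_free neq_ltn; apply/orP; left.
  exact: leq_ltn_trans (rank_leq_col M) ltBD.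
exists D; exists (fun mu => v 0 (enum_rank mu)); split.
  have [i vi] : exists i, v 0 i != 0.
    by apply/rV0Pn.
  by exists (enum_val i); rewrite enum_valK.
rewrite (reindex (enum_val (A := {ffun 'I_m -> 'I_D}))) /=; last first.
  by apply: onW_bij; exists enum_rank; [exact: enum_valK | exact: enum_rankK].
apply/mpolyP=> nu; rewrite raddf_sum /= mcoeff0.
have [small|big] := boolP [forall i, (nu i < B)%N].
  move/forallP in small.
  pose nu' := [ffun i => Ordinal (small i)].
  have -> : nu = mon nu' by apply/mnmP=> i; rewrite mnmE ffunE.
  have /rowP/(_ (enum_rank nu')) := vM; rewrite !mxE => {2}<-.
  by apply: eq_bigr => i _; rewrite mxE enum_rankK mcoeffZ enum_valK.
apply: big1 => i _; rewrite mcoeffZ.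
suff -> : (dual i)@_nu = 0 by rewrite mulr0.
apply/eqP; rewrite mcoeff_eq0; apply: msize_mdeg_ge.
have [j] := forallPn big; rewrite -leqNgt => lej.
have le_deg : (nu j <= mdeg nu)%N by rewrite mdegE (bigD1 j) //= leq_addr.
apply: leq_trans (leq_trans lej le_deg).
apply: leq_trans (leqSpred _) _; rewrite ltnS.
apply: leq_trans (mpred_size_prodX _ _) _.
rewrite /delta big_distrl /=; apply: leq_sum => l _.
by rewrite leq_mul2l (ltnW (ltn_ord _)) orbT.
Qed.

End Counting.

(** * Dimension of parametrized sets *)

Section Dimension.
Variables (R : realType).

(** If [R ^ N] maps polynomially onto a set whose Zariski closure contains [S],
    then [S] has dimension at most [N]. *)
Lemma prime_chain_le_nparam (k N : nat) (S : classical_sets.set ('I_k -> R))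
    (Phi : 'I_k -> {mpoly R[N]}) :
    (forall g : {mpoly R[k]}, (forall t, g.@[fun l => (Phi l).@[t]] = 0) ->
      vanishing_ideal S g) ->
  forall m P, prime_chain (vanishing_ideal S) m P -> (m <= N)%N.
Proof.
move=> closS m P chainP; rewrite leqNgt; apply/negP => ltNm.
have [_ P0 PS] := chainP.
have /fin_all_exists[f fP] (r : 'I_m) :
    exists f : {mpoly R[k]}, f \in P r.+1 /\ f \notin P r.
  by have [_ [f fP nfP]] := PS r (ltn_ord r); exists f.
pose Psi i := f i \mPo [tuple Phi l | l < k].
have [D [c [[mu cmu] c0]]] := mpoly_alg_dependent Psi ltNm.
suff /(prime_chain_indep chainP fP)/(_ mu)/eqP :
    \sum_mu c mu *: \prod_i f i ^+ mu i \in P 0%N by rewrite (negbTE cmu).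
apply/P0/closS => t.
have -> : (fun l => (Phi l).@[t]) =
    fun l => (tnth [tuple Phi l | l < k] l).@[t].
  by apply: boolp.funext => l; rewrite tnth_mktuple.
rewrite -comp_mpoly_meval [X in meval t X](_ : _ = 0) ?meval0 // -c0 raddf_sum.
apply: eq_bigr => nu _ /=.
rewrite comp_mpolyZ rmorph_prod; congr (_ *: _).
by apply: eq_bigr => i _; rewrite rmorphXn.
Qed.

(** Chains of primes over [S] pull back to [T] along a polynomial map
    [phi : S -> T] that has a polynomial left inverse [psi] on [S]: pulling
    polynomials back along [phi] is then surjective modulo the ideal of [S]. *)
Lemma prime_chain_retract (k l : nat) (S : classical_sets.set ('I_k -> R))
    (T : classical_sets.set ('I_l -> R))
    (phi : 'I_l -> {mpoly R[k]}) (psi : 'I_k -> {mpoly R[l]}) d P :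
    (forall x, S x -> T (fun j => (phi j).@[x])) ->
    (forall x, S x -> forall i, (psi i).@[fun j => (phi j).@[x]] = x i) ->
    prime_chain (vanishing_ideal S) d P ->
  prime_chain (vanishing_ideal T) d
    (fun r => [pred f | f \mPo [tuple phi j | j < l] \in P r]).
Proof.
move=> phiS psiK [prP P0 PS].
pose pull (f : {mpoly R[l]}) := f \mPo [tuple phi j | j < l].
have pullE f x : (pull f).@[x] = f.@[fun j => (phi j).@[x]].
  by rewrite comp_mpoly_meval; apply: meval_eq => j; rewrite tnth_mktuple.
have P0S f : vanishing_ideal S f -> forall r, (r <= d)%N -> f \in P r.
  move=> /P0 fP; elim=> [//|r IHr] r_d.
  by have [sub _] := PS r r_d; apply/sub/IHr/ltnW.
split.
- move=> r r_d; have [[P_0 P_1 clP] prM] := prP r r_d; split.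
    split; rewrite ?inE.
    + by rewrite comp_mpoly0.
    + by rewrite comp_mpoly1.
    + by move=> a u v; rewrite !inE comp_mpolyD rmorphM; apply: clP.
  by move=> u v; rewrite !inE rmorphM; apply: prM.
- move=> f fT; rewrite inE; apply: P0 => x Sx.
  by rewrite [LHS]pullE; apply/fT/phiS.
- move=> r r_d; have [sub [f fP fnP]] := PS r r_d; split.
    by move=> u; rewrite !inE; apply: sub.
  pose g := f \mPo [tuple psi i | i < k].
  have fgS : vanishing_ideal S (f - pull g).
    move=> x Sx; rewrite mevalB pullE comp_mpoly_meval; apply/eqP.
    rewrite subr_eq0; apply/eqP/meval_eq => i.
    by rewrite tnth_mktuple psiK.
  exists g; rewrite !inE -/(pull g).
    rewrite -[pull g](subKr f); apply: prime_idealB fP _; first exact: prP.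
    exact: P0S.
  apply: contra fnP => gP; rewrite -[f](subrK (pull g)).
  by apply: prime_idealD gP; [apply: prP (ltnW _) | apply: P0S (ltnW _)].
Qed.

(** The nonvanishing of all coordinates is a Zariski dense condition: any point
    lies on a line in the diagonal direction, which satisfies the condition at
    all but finitely many points. *)
Lemma meval_eq0_dense (N : nat) (q : {mpoly R[N]}) :
    (forall a, (forall i, a i != 0) -> q.@[a] = 0) ->
  forall a, q.@[a] = 0.
Proof.
move=> q0 a.
pose p := mmap (@polyC R) (fun i => (a i)%:P + 'X) q.
have pE s : p.[s] = q.@[fun i => a i + s].
  rewrite /p /mmap horner_sum mevalE; apply: eq_bigr => m _.
  rewrite hornerM hornerC /mmap1 horner_prod; congr (_ * _).
  by apply: eq_bigr => i _; rewrite horner_exp hornerD hornerC hornerX.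
(* w vanishes at the points of the line where some coordinate is 0. *)
pose w := \prod_i ('X + (a i)%:P).
suff /eqP : p * w = 0.
  rewrite mulf_eq0 => /orP[/eqP p0|/eqP w0].
    by rewrite (@meval_eq _ _ _ (fun i => a i + 0)) ?pE -?pE ?p0 ?horner0 // => i; rewrite addr0.
  have : w \is monic by apply: monic_prod => i _; rewrite monicXaddC.
  by rewrite w0 monicE lead_coef0 eq_sym oner_eq0.
apply/eqP; case: eqP => // /eqP pw0.
have root_pw s : root (p * w) s.
  rewrite rootM !rootE; have [/existsP[i /eqP as0]|/existsPn as_n0] :=
      boolP [exists i, a i + s == 0].
    by rewrite horner_prod (bigD1 i) //= hornerD hornerX hornerC addrC as0
      mul0r eqxx orbT.
  by rewrite pE q0 ?eqxx // => i; apply: as_n0.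
have := @max_poly_roots _ (p * w) [seq i%:R | i <- iota 0 (size (p * w))] pw0.
rewrite size_map size_iota ltnn map_inj_uniq ?iota_uniq; last first.
  by move=> i j /eqP; rewrite eqr_nat => /eqP.
have rootsP (rs : seq R) : all (root (p * w)) rs by apply/allP => s _.
by move=> /(_ (rootsP _) isT).
Qed.

End Dimension.

(** * Coefficients as functions of the compartmental matrix *)

Section IOCoefficient.
Variable n : nat.

(** The coefficient of degree [p] of the left-hand side of the input-output
    equations ([o = None]), or of the right-hand side that relates the input
    [i] to the output [j] ([o = Some (i, j)]), for a compartmental matrix [M]. *)
Definition io_coef (S : comNzRingType) (M : 'M[S]_n) (o : option ('I_n * 'I_n))
    (p : nat) : S :=
  (if o is Some ij then cofactor (char_poly_mx M) ij.1 ij.2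
   else char_poly M)`_p.

Lemma io_coef_map (S T : comNzRingType) (f : {rmorphism S -> T}) (M : 'M[S]_n)
    o p : io_coef (map_mx f M) o p = f (io_coef M o p).
Proof.
case: o => [[i j]|]; rewrite /io_coef -?map_char_poly ?coef_map //=.
by rewrite -map_char_poly_mx cofactor_map_mx /= coef_map.
Qed.

Lemma cofactor_det (S : comNzRingType) (M : 'M[S]_n) i j :
  cofactor M i j = \det (\matrix_(a, b) if a == i then (b == j)%:R else M a b).
Proof.
rewrite (expand_det_row _ i) (bigD1 j) //= big1 ?addr0 => [|b /negbTE b_j].
  rewrite mxE !eqxx mul1r; congr (_ * \det _); apply/matrixP=> a b.
  by rewrite !mxE eq_sym (negbTE (neq_lift _ _)).
by rewrite mxE eqxx b_j mul0r.
Qed.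

Lemma det_scale_rowcol (S : comNzRingType) (M : 'M[S]_n) (u v : 'I_n -> S) :
  \det (\matrix_(a, b) (u a * M a b * v b)) =
    (\prod_a u a) * \det M * (\prod_b v b).
Proof.
have -> : (\matrix_(a, b) (u a * M a b * v b)) =
    diag_mx (\row_a u a) *m M *m diag_mx (\row_b v b).
  by apply/matrixP=> a b; rewrite mul_mx_diag mul_diag_mx !mxE.
rewrite !det_mulmx !det_diag; congr (_ * _ * _);
  by apply: eq_bigr => a _; rewrite mxE.
Qed.

(** Rescaling the compartments conjugates the compartmental matrix by a diagonal
    matrix; it is invisible to the input-output equations when the inputs and
    the outputs are not rescaled. *)
Lemma io_coef_rescale (F : fieldType) (M : 'M[F]_n) (lam : 'I_n -> F)
    (B : {set 'I_n}) o p :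
    (forall v, lam v != 0) -> {in B, forall v, lam v = 1} ->
    (if o is Some ij then (ij.1 \in B) && (ij.2 \in B) else true) ->
  io_coef (\matrix_(a, b) (lam a * M a b * (lam b)^-1)) o p = io_coef M o p.
Proof.
move=> lam0 lamB oB.
have lamV a : (lam a)%:P * ((lam a)^-1)%:P = 1 :> {poly F}.
  by rewrite -polyCM mulfV.
have prodV : (\prod_a (lam a)%:P) * (\prod_a ((lam a)^-1)%:P) = 1 :> {poly F}.
  by rewrite -big_split /= big1.
have conjE : char_poly_mx (\matrix_(a, b) (lam a * M a b * (lam b)^-1)) =
    \matrix_(a, b) ((lam a)%:P * char_poly_mx M a b * ((lam b)^-1)%:P).
  apply/matrixP=> a b; rewrite !mxE mulrBr mulrBl -!polyCM; congr (_ - _).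
  have [<-|_] := eqVneq a b; last by rewrite !mulr0n mulr0 mul0r.
  by rewrite mulr1n mulrAC lamV mul1r.
case: o oB => [[i j] /= /andP[iB jB]|_]; congr ((polyseq _)`_p); last first.
  by rewrite /char_poly conjE det_scale_rowcol mulrAC prodV mul1r.
rewrite conjE !cofactor_det.
rewrite -[RHS]mul1r -prodV mulrAC -det_scale_rowcol; congr (\det _).
apply/matrixP=> a b; rewrite !mxE; case: eqP => [->|//].
rewrite lamB // polyC1 mul1r; case: eqP => [->|_]; last by rewrite mul0r.
by rewrite lamB // invr1 mulr1.
Qed.

End IOCoefficient.

(** The entries of [coefficients] are the values of [io_coef] at the positions
    [o] singled out by [In] and [Out]. *)
Definition io_position (n : nat) (In Out : {set 'I_n})
    (o : option ('I_n * 'I_n)) : bool :=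
  if o is Some ij then (ij.1 \in In) && (ij.2 \in Out) else true.

Section Model.
Variables (R : realType) (n : nat) (G : digraph n).

Lemma coefficientsP (In Out Leak : {set 'I_n}) q : Out != set0 ->
  reflect [/\ q != 0, q != 1 & exists o p, io_position In Out o /\
             q = io_coef (compartmental_matrix R G Leak) o p]
    (q \in coefficients R G In Out Leak).
Proof.
have in_coefs (r : {poly {mpoly R[nparam G Leak]}}) : q \in polyseq r ->
    exists p, q = r`_p.
  by move=> qr; exists (index q r); rewrite nth_index.
move=> Out0; rewrite mem_filter; apply: (iffP andP) =>
  [[/andP[q0 q1]]|[q0 q1 [o [p [oP qE]]]]].
  case/flattenP=> s /mapP[j]; rewrite mem_enum => jOut ->.
  rewrite mem_cat => /orP[/in_coefs[p qE]|].
    by split=> //; exists None, p.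
  case/flattenP=> t /mapP[i]; rewrite mem_enum => iIn -> /in_coefs[p qE].
  by split=> //; exists (Some (i, j)), p; rewrite /= iIn jOut.
have [j0 j0Out] := set0Pn _ Out0; split; first by rewrite q0.
have qs (r : {poly _}) : q = r`_p -> q \in polyseq r.
  move=> qr; rewrite qr mem_nth // ltnNge; apply: contra q0 => le_r.
  by rewrite qr nth_default.
case: o oP qE => [[i j] /= /andP[iIn jOut]|_] /qs q_in; apply/flattenP.
  eexists; first by apply: map_f; rewrite mem_enum; exact: jOut.
  rewrite mem_cat; apply/orP; right; apply/flattenP.
  by eexists; first by apply: map_f; rewrite mem_enum; exact: iIn.
eexists; first by apply: map_f; rewrite mem_enum; exact: j0Out.
by rewrite mem_cat q_in.
Qed.

Lemma edge_param_arc (Leak : {set 'I_n}) i j : (j, i) \in edges G ->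
  exists e, edge_param R G Leak i j = 'X_e.
Proof.
move=> ji; rewrite /edge_param; case: pickP => [e _|]; first by eexists.
by move=> /(_ (enum_rank_in ji (j, i))); rewrite enum_rankK_in ?eqxx.
Qed.

Lemma edge_param_not_arc (Leak : {set 'I_n}) i j : (j, i) \notin edges G ->
  edge_param R G Leak i j = 0.
Proof.
move=> ji; rewrite /edge_param; case: pickP => [e /eqP eE|//].
by case/negP: ji; rewrite -eE enum_valP.
Qed.

(** * Removing leaks *)

Section RemoveLeaks.
Variables (L Leak : {set 'I_n}) (sLLeak : L \subset Leak).

(** The substitution that sets to 0 the parameters of the leaks outside [L]. *)
Definition kept_params : (nparam G Leak).-tuple {mpoly R[nparam G L]} :=
  [tuple match split v with
         | inl e => 'X_(lshift #|L| e)
         | inr l => leak_param R G L (enum_val l)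
         end | v < nparam G Leak].

Local Notation remove_leaks := (comp_mpoly kept_params).

Lemma remove_leaks_matrix :
  map_mx remove_leaks (compartmental_matrix R G Leak) =
    compartmental_matrix R G L.
Proof.
have edgeE i j : remove_leaks (edge_param R G Leak i j) = edge_param R G L i j.
  rewrite /edge_param; case: pickP => [e _|_]; last exact: rmorph0.
  by rewrite comp_mpolyXU -tnth_nth tnth_mktuple (unsplitK (inl e)).
have leakE i : remove_leaks (leak_param R G Leak i) = leak_param R G L i.
  rewrite {1}/leak_param; case: pickP => [l /eqP lE|l_n].
    by rewrite comp_mpolyXU -tnth_nth tnth_mktuple
      (unsplitK (inr l)) lE.
  rewrite rmorph0 /leak_param; case: pickP => [l /eqP lE|//].
  have iLeak : i \in Leak by rewrite -lE (subsetP sLLeak) ?enum_valP.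
  by have := l_n (enum_rank_in iLeak i); rewrite enum_rankK_in ?eqxx.
apply/matrixP=> i j; rewrite !mxE; case: eqP => _; last exact: edgeE.
rewrite rmorphB rmorphN rmorph_sum; congr (- _ - _); first exact: leakE.
by apply: eq_bigr => k _; apply: edgeE.
Qed.

Variables (In Out : {set 'I_n}) (Out_neq0 : Out != set0).

(** The image of the coefficient map of the model with leaks [L] is, up to
    repeated and constant coordinates, contained in that of the model with leaks
    [Leak]. *)
Lemma prime_chain_remove_leaks d P :
    prime_chain (vanishing_ideal
      (classical_sets.range (@coefficient_map R n G In Out L))) d P ->
  exists P', prime_chain (vanishing_ideal
    (classical_sets.range (@coefficient_map R n G In Out Leak))) d P'.
Proof.
pose CL := coefficients R G In Out L.
pose C := coefficients R G In Out Leak.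
(* A coordinate of the larger model restricts to one of the smaller model or to
   the constant 0 or 1: phi expresses it in terms of the coordinates of the
   smaller model. Conversely sec lifts each coordinate of the smaller model. *)
pose q_ (l : 'I_(size C)) := remove_leaks (tnth (in_tuple C) l).
have q_P l : [\/ q_ l = 0, q_ l = 1 | q_ l \in CL].
  have [->|q0] := eqVneq (q_ l) 0; first by constructor.
  have [->|q1] := eqVneq (q_ l) 1; first by constructor.
  constructor; apply/coefficientsP => //; split=> //.
  have /coefficientsP[//|_ _ [o [p [oP qE]]]] := mem_tnth l (in_tuple C).
  by exists o, p; split=> //; rewrite -remove_leaks_matrix io_coef_map -qE.
have /fin_all_exists[phi phiP] (l : 'I_(size C)) : exists f : {mpoly R[size CL]},
    forall a, f.@[coefficient_map a] = (q_ l).@[a].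
  case: (q_P l) => [->|->|/seq_tnthP[l' ->]].
  - by exists 0 => a; rewrite !meval0.
  - by exists 1 => a; rewrite !meval1.
  - by exists 'X_l' => a; rewrite mevalXU.
have /fin_all_exists[sec secP] (l' : 'I_(size CL)) :
    exists l, q_ l = tnth (in_tuple CL) l'.
  have := mem_tnth l' (in_tuple CL).
  move: (tnth _ _) => q /coefficientsP[//|q0 q1 [o [p [oP qE]]]].
  have qE' : q = remove_leaks (io_coef (compartmental_matrix R G Leak) o p).
    by rewrite -io_coef_map remove_leaks_matrix.
  suff /seq_tnthP[l lE] : io_coef (compartmental_matrix R G Leak) o p \in C.
    by exists l; rewrite /q_ -[tnth _ _]lE.
  apply/coefficientsP => //; split; last by exists o, p.
    by apply: contra q0 => /eqP q0; rewrite qE' q0 rmorph0.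
  by apply: contra q1 => /eqP q1; rewrite qE' q1 rmorph1.
move=> chainP; eexists.
apply: (prime_chain_retract (phi := phi) (psi := fun l' => 'X_(sec l')) _ _ chainP).
- move=> _ [a _ <-].
  exists (fun v => (remove_leaks 'X_v).@[a]) => //.
  apply: boolp.funext => l; rewrite phiP /q_ /coefficient_map.
  rewrite comp_mpoly_meval; apply: meval_eq => v.
  by rewrite comp_mpolyXU -tnth_nth.
- move=> _ [a _ <-] l'.
  by rewrite mevalXU phiP secP.
Qed.

End RemoveLeaks.

End Model.

(** * Scaling the compartments *)

Section SpanningForest.
Variables (n : nat) (G : digraph n) (B : {set 'I_n}).

Lemma strongly_connected_connected : strongly_connected G -> connected_graph G.
Proof.
move=> conG u v; apply: connect_sub (conG u v) => x y xy.
by apply: connect1; rewrite xy.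
Qed.

(** In a connected graph, each vertex outside [B] has a neighbour [par v] that is
    closer to [B]; the edges [e v] between [v] and [par v] form a spanning
    forest rooted at [B]. *)
Lemma spanning_forest : connected_graph G -> B != set0 ->
  exists (par : 'I_n -> 'I_n) (rk : 'I_n -> nat) (e : 'I_n -> 'I_n * 'I_n),
    forall v, v \notin B ->
      [/\ e v \in edges G, (e v == (v, par v)) || (e v == (par v, v))
        & (rk (par v) < rk v)%N].
Proof.
move=> conG /set0Pn[b bB].
pose adj x y := Defs.arc G x y || Defs.arc G y x.
pose reach k v := [exists t : k.-tuple 'I_n, path adj v t && (last v t \in B)].
have ex_reach v : exists k, reach k v.
  have /connectP[p v_p bE] := conG v b.
  exists (size p); apply/existsP; exists (in_tuple p).
  by rewrite v_p /= -bE bB.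
pose rk v := ex_minn (ex_reach v).
have closer v : exists w, v \notin B -> adj v w /\ (rk w < rk v)%N.
  have [vB|vB] := boolP (v \in B); first by exists v.
  rewrite {2}/rk; case: ex_minnP => -[|k] /existsP[t /andP[v_t tB]] _.
    by rewrite (tuple0 t) (negbTE vB) in tB.
  case: t v_t tB => -[//|w s] /= size_s /andP[vw w_s] sB.
  exists w => _; split=> //; rewrite /rk; case: ex_minnP => m _; rewrite ltnS; apply.
  by apply/existsP; exists (Tuple size_s); rewrite w_s.
have [par parP] := fin_all_exists closer.
exists par, rk; exists (fun v => if (v, par v) \in edges G then (v, par v) else (par v, v)).
move=> v /parP[v_par lt_rk]; split=> //; last by case: ifP => _; rewrite eqxx ?orbT.
by case: ifP v_par => // vpar; rewrite /adj /Defs.arc vpar.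
Qed.

Variables (par : 'I_n -> 'I_n) (rk : 'I_n -> nat) (e : 'I_n -> 'I_n * 'I_n).
Hypothesis forestP : forall v, v \notin B ->
  [/\ e v \in edges G, (e v == (v, par v)) || (e v == (par v, v))
    & (rk (par v) < rk v)%N].

Lemma card_forest : #|e @: ~: B| = #|~: B|.
Proof.
apply: card_in_imset => u v; rewrite !inE => uB vB euv.
have [_ eu rku] := forestP uB; have [_ ev rkv] := forestP vB.
move: eu; rewrite euv; case/orP: ev => /eqP->; rewrite !xpair_eqE => /orP[] /andP[].
- by move=> /eqP.
- move=> /eqP vpu /eqP pvu; move: rku; rewrite -vpu => rku.
  by rewrite pvu in rkv; have := ltn_trans rku rkv; rewrite ltnn.
- move=> /eqP pvu /eqP vpu; move: rku; rewrite -vpu => rku.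
  by rewrite pvu in rkv; have := ltn_trans rku rkv; rewrite ltnn.
- by move=> _ /eqP.
Qed.

Variable F : fieldType.

(** The scaling factors are determined from the roots to the leaves of the
    forest. *)
Lemma forest_potential (w : 'I_n -> F) : (forall v, v \notin B -> w v != 0) ->
  exists lam : 'I_n -> F, [/\ forall v, lam v != 0, {in B, forall v, lam v = 1}
    & forall v, v \notin B -> lam v = lam (par v) * w v].
Proof.
move=> w0.
suff main k : exists lam : 'I_n -> F,
    [/\ forall v, lam v != 0, {in B, forall v, lam v = 1}
      & forall v, (rk v < k)%N -> v \notin B -> lam v = lam (par v) * w v].
  have [lam [lam0 lamB lamP]] := main (\max_v rk v).+1.
  by exists lam; split=> // v; apply: lamP; rewrite ltnS leq_bigmax.
elim: k => [|k [lam [lam0 lamB lamP]]].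
  by exists (fun=> 1); split=> // v; rewrite oner_eq0.
exists (fun v => if v \in B then 1 else lam (par v) * w v); split=> [v|v ->//|v].
  by case: ifPn => [_|/w0 wv]; rewrite ?oner_eq0 ?mulf_neq0.
move=> lt_vk vB; rewrite (negbTE vB); congr (_ * _).
case: ifPn => [/lamB//|pB]; apply: lamP => //.
by have [_ _ lt_rk] := forestP vB; apply: leq_trans lt_rk _.
Qed.

(** A matrix with nonzero entries along the forest is diagonally conjugate to
    one whose entries along the forest are 1. *)
Lemma forest_normalize (M : 'M[F]_n) :
    (forall v, v \notin B -> M (e v).2 (e v).1 != 0) ->
  exists lam : 'I_n -> F, [/\ forall v, lam v != 0, {in B, forall v, lam v = 1}
    & forall v, v \notin B ->
        lam (e v).2 * M (e v).2 (e v).1 * (lam (e v).1)^-1 = 1].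
Proof.
move=> M0.
pose x v := M (e v).2 (e v).1.
have w0 v : v \notin B -> (if e v == (v, par v) then x v else (x v)^-1) != 0.
  by move=> /M0 xv; case: ifP => _; rewrite ?invr_eq0.
have [lam [lam0 lamB lamP]] := forest_potential w0.
exists lam; split=> // v vB; have xv : x v != 0 := M0 v vB.
have [_ ev _] := forestP vB; have := lamP v vB; rewrite -/(x v).
case: eqP ev => [-> _|_ /= /eqP->] /= lamv.
  by rewrite -lamv mulfV.
by rewrite lamv mulfVK // mulfV.
Qed.

End SpanningForest.

Section UpperBound.
Variables (R : realType) (n : nat) (G : digraph n).
Variables (In Out Leak : {set 'I_n}).

(** At most [#|E| + #|In :|: Out|] parameters remain once the compartments outside
    [In :|: Out] are rescaled so that the edges of a spanning forest rooted at
    [In :|: Out] have parameter 1. *)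
Lemma prime_chain_expected_le :
    connected_graph G -> Out != set0 ->
  forall m P, prime_chain (vanishing_ideal
      (classical_sets.range (@coefficient_map R n G In Out Leak))) m P ->
  (m <= #|edges G| + #|In :|: Out|)%N.
Proof.
move=> conG Out0 m P chainP.
set B := In :|: Out.
have [v0 v0Out] := set0Pn _ Out0.
have B0 : B != set0 by apply/set0Pn; exists v0; rewrite inE v0Out orbT.
have [par [rk [e forestP]]] := spanning_forest conG B0.
pose F := e @: ~: B.
have subF : F \subset edges G.
  by apply/subsetP=> _ /imsetP[v + ->]; rewrite inE => /forestP[].
(* The positions, written (column, row), of the entries that are not
   normalized. *)
pose K := (edges G :\: F) :|: [set (v, v) | v : 'I_n].
have Kv0 : (v0, v0) \in K by rewrite inE [X in _ || X]imset_f ?orbT.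
have leK : (#|K| <= #|edges G| + #|B|)%N.
  apply: leq_trans (leq_card_setU _ _) _.
  rewrite card_imset => [|u v [] //]; rewrite -(cardsC B).
  rewrite cardsD (setIidPr subF) (card_forest forestP).
  rewrite addnCA subnK 1?addnC // -(card_forest forestP).
  exact: subset_leq_card.
apply: leq_trans leK.
pose NF : 'M[{mpoly R[#|K|]}]_n := \matrix_(i, j)
  if (j, i) \in K then 'X_(enum_rank_in Kv0 (j, i)) else ((j, i) \in F)%:R.
have /fin_all_exists[pos posP] (l : 'I_(size (coefficients R G In Out Leak))) :
    exists op, io_position In Out op.1 /\
      tnth (in_tuple (coefficients R G In Out Leak)) l =
        io_coef (compartmental_matrix R G Leak) op.1 op.2.
  have /coefficientsP[//|_ _ [o [p [oP qE]]]] :=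
    mem_tnth l (in_tuple (coefficients R G In Out Leak)).
  by exists (o, p).
apply: (prime_chain_le_nparam
  (Phi := fun l => io_coef NF (pos l).1 (pos l).2)) chainP => g g0 _ [a _ <-].
pose q := g \mPo in_tuple (coefficients R G In Out Leak).
suff q0 b : q.@[b] = 0 by rewrite -[RHS](q0 a) comp_mpoly_meval.
move: b; apply: meval_eq0_dense => b b0; rewrite comp_mpoly_meval.
pose M := map_mx (meval b) (compartmental_matrix R G Leak).
(* Entries along the forest are parameters of edges, hence nonzero at b. *)
have M0 v : v \notin B -> M (e v).2 (e v).1 != 0.
  move=> /forestP[+ _ _]; case: (e v) => j i /= ji.
  rewrite !mxE; have [ij|_] := eqVneq i j.
    by rewrite ij (negbTE (edges_noloop G j)) in ji.
  by have [x ->] := edge_param_arc R Leak ji; rewrite mevalXU.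
have [lam [lam0 lamB lamP]] := forest_normalize forestP M0.
pose M' := \matrix_(i, j) (lam i * M i j * (lam j)^-1).
pose t (x : 'I_#|K|) := M' (enum_val x).2 (enum_val x).1.
have NFt : map_mx (meval t) NF = M'.
  apply/matrixP=> i j; rewrite 2!mxE; case: ifPn => [ijK|].
    by rewrite mevalXU /t enum_rankK_in.
  rewrite !inE negb_or negb_and negbK => /andP[ji_F /imsetP ji_n].
  rewrite rmorph_nat; case: (boolP (_ \in F)) ji_F => [/imsetP[v]|_ /= ji_E].
    rewrite inE => /lamP lamv eE; rewrite -eE /= in lamv.
    by rewrite [RHS]mxE lamv.
  rewrite !mxE; have [ij|_] := eqVneq i j; first by case: ji_n; exists i; rewrite ?ij.
  by rewrite edge_param_not_arc // meval0 mulr0 mul0r.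
rewrite -[RHS](g0 t); apply: meval_eq => l.
have [oP ->] := posP l.
rewrite -!io_coef_map NFt (@io_coef_rescale _ _ M lam B) //.
by case: (pos l).1 oP => //= -[i j] /= /andP[iIn jOut]; rewrite !inE iIn jOut orbT.
Qed.

End UpperBound.

Theorem theorem4p1 (R : realType) (n : nat) (G : digraph n)
    (In Out L : {set 'I_n})
    (In_neq0 : In != set0) (Out_neq0 : Out != set0)
    (card_L : #|L| = #|In :|: Out|)
    (G_connected :
       (strongly_io_connected G In Out /\ #|Out| = 1%N) \/
       (strongly_connected G /\ #|In| = 1%N))
    (L_expected : expected_dimension R G In Out L) :
  (forall k : 'I_n, expected_dimension R G In Out (k |: L)) /\
  (forall Leak : {set 'I_n}, L \subset Leak ->
     expected_dimension R G In Out Leak).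
Proof.
have conG : connected_graph G.
  by case: G_connected => -[] => [[]//|/strongly_connected_connected].
suff main (Leak : {set 'I_n}) : L \subset Leak -> expected_dimension R G In Out Leak.
  by split=> // k; apply/main/subsetUr.
move=> sLLeak; split; last exact: prime_chain_expected_le.
by have [[P chainP] _] := L_expected; apply: prime_chain_remove_leaks chainP.
Qed.
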